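(* Let $\gamma\in(0,1)$ be irrational and define $s(n)=\lfloor (n+1)\gamma\rfloor$ for integers $n\ge 0$. Let $L(n)=\big\lfloor \tfrac{1}{\gamma}n\big\rfloor$ and $U(n)=\big\lfloor \tfrac{1}{1-\gamma}n\big\rfloor$ for $n\ge 0$. Then for all $n\ge 0$, $$s(L(n))=n,\qquad s(U(n))=\Big\lfloor \frac{\gamma}{1-\gamma}\,n\Big\rfloor .$$ *)

(* Defs.v *)
From mathcomp Require Import all_boot all_order all_algebra.
From mathcomp Require Import classical_sets reals.

Set Implicit Arguments.
Unset Strict Implicit.
Unset Printing Implicit Defensive.

Local Open Scope ring_scope.

(* Indices live in int, so that floors can be composed without casts; only
   nonnegative indices are meaningful, and L, U preserve nonnegativity when
   0 < gamma < 1. *)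
Definition s (R : realType) (gamma : R) (n : int) : int :=
  Num.floor ((n + 1)%:~R * gamma).

Definition L (R : realType) (gamma : R) (n : int) : int :=
  Num.floor (1 / gamma * n%:~R).

Definition U (R : realType) (gamma : R) (n : int) : int :=
  Num.floor (1 / (1 - gamma) * n%:~R).

(* Main.v *)
Require Import Defs.
From mathcomp Require Import all_boot all_order all_algebra.
From mathcomp Require Import classical_sets reals.
From mathcomp Require Import ring lra.

Import Order.TTheory GRing.Theory Num.Theory.

Local Open Scope ring_scope.

(** Clearing the denominator, m = floor(n/a) satisfies m a <= n < (m+1) a. For a = gamma this
    locates (m+1) gamma directly ([s_L]); for a = 1 - gamma it does so through (m+1) gamma = (m+1) -
    (m+1)(1 - gamma) ([s_U]). Both sides of the second identity equal [U gamma n - n]. *)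

Lemma floor_divr_itv (R : realType) (a : R) (n : int) : 0 < a ->
  (Num.floor (1 / a * n%:~R))%:~R * a <= n%:~R
    < ((Num.floor (1 / a * n%:~R))%:~R + 1) * a.
Proof.
move=> a_gt0; have := floor_itv (1 / a * n%:~R).
by rewrite intrD div1r mulrC ler_pdivlMr // ltr_pdivrMr.
Qed.

(** With m = [L gamma n]: n < (m+1) gamma = m gamma + gamma <= n + gamma < n + 1. *)
Lemma s_L (R : realType) (gamma : R) (n : int) : 0 < gamma < 1 ->
  s gamma (L gamma n) = n.
Proof.
case/andP=> gamma_gt0 gamma_lt1; apply: floor_def.
have /andP[] := floor_divr_itv R gamma n gamma_gt0.
rewrite /L; set m := Num.floor _; rewrite !intrD => ? ?.
by apply/andP; split; lra.
Qed.

Lemma s_U (R : realType) (gamma : R) (n : int) : 0 < gamma < 1 ->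
  s gamma (U gamma n) = U gamma n - n.
Proof.
case/andP=> gamma_gt0 gamma_lt1; apply: floor_def.
have gammaC_gt0 : 0 < 1 - gamma by rewrite subr_gt0.
have /andP[] := floor_divr_itv R (1 - gamma) n gammaC_gt0.
rewrite /U; set m := Num.floor _; rewrite !intrD mulrNz => ? ?.
(* Lower bound: m - n <= m gamma < (m+1) gamma. Upper bound: n < (m+1)(1 - gamma) rearranges to
   (m+1) gamma < m - n + 1. *)
by apply/andP; split; lra.
Qed.

(** Since gamma/(1 - gamma) = 1/(1 - gamma) - 1, the two arguments of floor differ by the integer
    n. *)
Lemma floor_mul_gamma_div (R : realType) (gamma : R) (n : int) : gamma < 1 ->
  Num.floor (gamma / (1 - gamma) * n%:~R) = U gamma n - n.
Proof.
move=> gamma_lt1.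
have gammaC_neq0 : 1 - gamma != 0 by rewrite gt_eqF // subr_gt0.
have -> : gamma / (1 - gamma) = 1 / (1 - gamma) - 1.
  by field.
by rewrite mulrBl (mul1r n%:~R) -mulrNz floorDrz ?intr_int // intrKfloor.
Qed.

Theorem theorem2 (R : realType) (gamma : R)
    (gamma_gt0 : 0 < gamma) (gamma_lt1 : gamma < 1)
    (gamma_irr : irrational gamma) :
  forall n : int, 0 <= n ->
    s gamma (L gamma n) = n /\
    s gamma (U gamma n) = Num.floor (gamma / (1 - gamma) * n%:~R).
Proof.
move=> n _; have gamma01 : 0 < gamma < 1 by apply/andP.
by split; [exact: s_L | rewrite s_U // floor_mul_gamma_div].
Qed.
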